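(* Let $N\ge 1$, let $H^\alpha:\mathbb{R}\to\mathbb{R}$, $\alpha=1,\dots,N$, be continuous and coercive ($H^\alpha(s)\to+\infty$ as $|s|\to+\infty$), and let $F_0:\mathbb{R}^N\to\mathbb{R}$ be continuous and nonincreasing in each of its arguments. Let $T\in(0,+\infty]$ and consider the junction problem $$\begin{cases}u_t+H^\alpha(u_x)=0 & \text{for } t\in(0,T),\ x\in J_\alpha^*,\ \alpha=1,\dots,N,\\ u_t+F_0(u_x)=0 & \text{for } t\in(0,T),\ x=0.\end{cases}$$ Let $u$ be an upper semi-continuous function on $(0,T)\times J$. (i) If $u$ is a weak $F_0$-subsolution and $u$ satisfies the weak continuity condition $$u(t,0)=\limsup_{(s,y)\to(t,0),\ y\in J_\alpha^*}u(s,y)\quad\text{for all } t\in(0,T)\text{ and each }\alpha=1,\dots,N,$$ then $u$ is a strong $\mathfrak{R}F_0$-subsolution. (ii) If $u$ is a strong $\mathfrak{R}F_0$-subsolution, then $u$ is a weak $F_0$-subsolution. Let $v$ be a lower semi-continuous function on $(0,T)\times J$. (i) If $v$ is a weak $F_0$-supersolution, then $v$ is a strong $\mathfrak{R}F_0$-supersolution. (ii) If $v$ is a strong $\mathfrak{R}F_0$-supersolution, then $v$ is a weak $F_0$-supersolution.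
   Context: Junction: $J=\bigcup_{\alpha=1}^N J_\alpha$, where the $J_\alpha$ are $N$ copies of $[0,+\infty)$ glued at the origin, so $J_\alpha\cap J_\beta=\{0\}$ for $\alpha\ne\beta$; $J_\alpha^*=J_\alpha\setminus\{0\}$. For a function $\varphi$ on $(0,T)\times J$, $\varphi_x(t,x)=\partial_\alpha\varphi(t,x)$ (derivative along the branch) if $x\in J_\alpha^*$, and $\varphi_x(t,0)=(\partial_1\varphi(t,0^+),\dots,\partial_N\varphi(t,0^+))\in\mathbb{R}^N$. Test functions: $\varphi$ continuous on $(0,T)\times J$ whose restriction to each $(0,T)\times J_\alpha$ is $C^1$ (up to $x=0$). ''$\varphi$ touches $u$ from above (resp. below) at $(t_0,x_0)$'' means $\varphi\ge u$ (resp. $\varphi\le u$) in a neighborhood of $(t_0,x_0)$, with equality at $(t_0,x_0)$. For $p\in\mathbb{R}^N$, $H_{\min}(p)=\min_\alpha H^\alpha(p^\alpha)$, $H_{\max}(p)=\max_\alpha H^\alpha(p^\alpha)$; $q\le p$ is componentwise. Weak $F_0$-subsolution (resp. supersolution): the upper semicontinuous envelope $u^*$ is locally bounded from above (resp. the lower semicontinuous envelope $u_*$ is locally bounded from below), and for every test function $\varphi$ touching $u^*$ from above (resp. $u_*$ from below) at $(t_0,x_0)\in(0,T)\times J$: if $x_0\in J_\alpha^*$, then $\varphi_t+H^\alpha(\varphi_x)\le 0$ (resp. $\ge 0$) at $(t_0,x_0)$; if $x_0=0$, then $\varphi_t+\min\{F_0(\varphi_x),H_{\min}(\varphi_x)\}\le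 0$ (resp. $\varphi_t+\max\{F_0(\varphi_x),H_{\max}(\varphi_x)\}\ge 0$) at $(t_0,0)$. Strong $F$-subsolution (resp. supersolution), for a function $F:\mathbb{R}^N\to\mathbb{R}$: same definition, except that at $x_0=0$ the requirement is $\varphi_t+F(\varphi_x)\le 0$ (resp. $\ge 0$). Relaxation: $\underline R F(p)=\sup_{q\ge p}\min\{F(q),H_{\min}(q)\}$, $\overline R F(p)=\inf_{q\le p}\max\{F(q),H_{\max}(q)\}$, and $\mathfrak{R}F_0:=\underline R\,\overline R F_0=\overline R\,\underline R F_0$ (these two are known to coincide under the stated assumptions). *)

(* Defs.v *)
Set Warnings "-notation-overridden,-notation-incompatible-prefix,-ambiguous-paths".

From HB Require Import structures.
From mathcomp Require Export all_boot all_order all_algebra.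
From mathcomp Require Export all_classical all_reals all_analysis.

Set Implicit Arguments.
Unset Strict Implicit.
Unset Printing Implicit Defensive.

Export Order.TTheory GRing.Theory Num.Theory.
Export numFieldNormedType.Exports.

Local Open Scope classical_set_scope.
Local Open Scope ring_scope.

Section Junction.
Context {R : realType} {n : nat}.

(** The junction of N = n.+1 half-lines is realised as the union of the
    nonnegative half-axes of R^N, with the induced topology. *)

Definition axis (a : 'I_n.+1) (r : R) : 'rV[R]_n.+1 := r *: delta_mx 0 a.

Definition branch (a : 'I_n.+1) : set 'rV[R]_n.+1 :=
  [set axis a r | r in [set r | 0 <= r]].

Definition open_branch (a : 'I_n.+1) : set 'rV[R]_n.+1 :=
  [set axis a r | r in [set r | 0 < r]].

Definition junction : set 'rV[R]_n.+1 := \bigcup_(a : 'I_n.+1) branch a.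

Definition time_interval (T : \bar R) : set R :=
  [set t | 0 < t /\ (t%:E < T)%E].

(** A function on (0,T) x J is a total function on R x R^N, of which only the
    values on [dom T] matter: every notion below is relative to that set. *)
Definition dom (T : \bar R) : set (R * 'rV[R]_n.+1) :=
  time_interval T `*` junction.

Implicit Types (T : \bar R) (u v phi : R * 'rV[R]_n.+1 -> R)
  (z : R * 'rV[R]_n.+1) (w : R * 'rV[R]_n.+1 -> \bar R)
  (p q : 'rV[R]_n.+1) (F G : 'rV[R]_n.+1 -> R) (H : 'I_n.+1 -> R -> R).

Definition lsc_on T v : Prop :=
  lower_semicontinuous (fun z : subspace (dom T) => (v z)%:E).

Definition usc_on T u : Prop := lsc_on T (fun z => - u z).

Definition usc_envelope T u z : \bar R :=
  limf_esup (EFin \o u) (within (dom T) (nbhs z)).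

Definition lsc_envelope T v z : \bar R :=
  limf_einf (EFin \o v) (within (dom T) (nbhs z)).

Definition locally_bounded_above T w : Prop :=
  forall z, dom T z ->
    exists M : R, \forall y \near within (dom T) (nbhs z), (w y <= M%:E)%E.

Definition locally_bounded_below T w : Prop :=
  forall z, dom T z ->
    exists M : R, \forall y \near within (dom T) (nbhs z), (M%:E <= w y)%E.

Definition d_t phi z : R := derive1 (fun s => phi (s, z.2)) z.1.

(** Difference quotient along J_a at abscissa r. Since it is restricted to
    s >= 0, its limit as s -> r is the usual derivative for r > 0 and the right
    derivative for r = 0. *)
Definition branch_quotient phi (a : 'I_n.+1) (t r s : R) : R :=
  (phi (t, axis a s) - phi (t, axis a r)) / (s - r).

Definition d_x phi (a : 'I_n.+1) (t r : R) : R :=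
  lim (branch_quotient phi a t r s @[s --> within [set s | 0 <= s] r^']).

Definition grad0 phi (t : R) : 'rV[R]_n.+1 := \row_a d_x phi a t 0.

Definition C1_on_branch T phi (a : 'I_n.+1) : Prop :=
  let strip := time_interval T `*` [set r : R | 0 <= r] in
  [/\ forall t r, strip (t, r) ->
        derivable (fun s => phi (s, axis a r)) t 1,
      forall t r, strip (t, r) ->
        cvg (branch_quotient phi a t r s @[s --> within [set s | 0 <= s] r^']),
      {within strip, continuous (fun y => d_t phi (y.1, axis a y.2))} &
      {within strip, continuous (fun y => d_x phi a y.1 y.2)}].

Definition test_function T phi : Prop :=
  {within dom T, continuous phi} /\ forall a, C1_on_branch T phi a.

Definition touches_above T phi w z : Prop :=
  (\forall y \near within (dom T) (nbhs z), (w y <= (phi y)%:E)%E) /\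
  w z = (phi z)%:E.

Definition touches_below T phi w z : Prop :=
  (\forall y \near within (dom T) (nbhs z), ((phi y)%:E <= w y)%E) /\
  w z = (phi z)%:E.

Definition Hmin H p : R :=
  \big[Num.min/H ord0 (p 0 ord0)]_(a < n.+1) H a (p 0 a).

Definition Hmax H p : R :=
  \big[Num.max/H ord0 (p 0 ord0)]_(a < n.+1) H a (p 0 a).

Definition subsolution T H G u : Prop :=
  locally_bounded_above T (usc_envelope T u) /\
  forall phi t, test_function T phi -> time_interval T t ->
    (forall a r, 0 < r ->
       touches_above T phi (usc_envelope T u) (t, axis a r) ->
       d_t phi (t, axis a r) + H a (d_x phi a t r) <= 0) /\
    (touches_above T phi (usc_envelope T u) (t, 0) ->
       d_t phi (t, 0) + G (grad0 phi t) <= 0).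

Definition supersolution T H G v : Prop :=
  locally_bounded_below T (lsc_envelope T v) /\
  forall phi t, test_function T phi -> time_interval T t ->
    (forall a r, 0 < r ->
       touches_below T phi (lsc_envelope T v) (t, axis a r) ->
       0 <= d_t phi (t, axis a r) + H a (d_x phi a t r)) /\
    (touches_below T phi (lsc_envelope T v) (t, 0) ->
       0 <= d_t phi (t, 0) + G (grad0 phi t)).

Definition strong_subsolution T H F u : Prop := subsolution T H F u.

Definition strong_supersolution T H F v : Prop := supersolution T H F v.

Definition weak_subsolution T H F u : Prop :=
  subsolution T H (fun p => Num.min (F p) (Hmin H p)) u.

Definition weak_supersolution T H F v : Prop :=
  supersolution T H (fun p => Num.max (F p) (Hmax H p)) v.

Definition weakly_continuous T u : Prop :=
  forall t, time_interval T t -> forall a : 'I_n.+1,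
    (u (t, 0))%:E =
    limf_esup (EFin \o u)
      (within (time_interval T `*` open_branch a) (nbhs (t, 0 : 'rV[R]_n.+1))).

Definition lecomp p q : Prop := forall a, p 0 a <= q 0 a.

(** [sup] and [inf] are real-valued, with a junk value for unbounded sets. For
    F nonincreasing in each argument the sets below are nonempty, the first one
    bounded above and the second one bounded below by F p, and both relaxations
    are again nonincreasing, so the junk value never occurs. *)
Definition relax_sub H F p : R :=
  sup [set Num.min (F q) (Hmin H q) | q in [set q | lecomp p q]].

Definition relax_super H F p : R :=
  inf [set Num.max (F q) (Hmax H q) | q in [set q | lecomp q p]].

(** For continuous coercive [H a] and continuous nonincreasing F, the two
    relaxations commute, so their order is immaterial. *)
Definition relaxation H F : 'rV[R]_n.+1 -> R := relax_sub H (relax_super H F).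

Definition coercive (h : R -> R) : Prop :=
  (h s @[s --> +oo] --> +oo) /\ (h s @[s --> -oo] --> +oo).

Definition nonincreasing_each F : Prop :=
  forall (a : 'I_n.+1) p q,
    (forall b, b != a -> p 0 b = q 0 b) -> p 0 a <= q 0 a -> F q <= F p.

End Junction.

(* Main.v *)
Require Import Defs.
From mathcomp Require Import all_boot all_order all_algebra.
From mathcomp Require Import all_classical all_reals all_analysis.
From mathcomp Require Import ring lra.

(** Only the condition at the junction point distinguishes the two notions. A
    strong solution is a weak one because
    min(F, H_min) <= RF <= max(F, H_max). Conversely, let phi touch v from below
    at (t0, 0), let l = - phi_t, and let s_a be the critical slope on J_a, the
    supremum of the slopes for which phi, corrected linearly along J_a, still
    touches v from below. If s_a is finite then H_a(s_a) >= l; if not, some slope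
    above phi_x satisfies the same inequality by coercivity. The weak condition
    holds for every vector of slopes below the critical ones, and s_a is then a
    competitor in the supremum defining RF, which gives RF(phi_x) >= l.
    Subsolutions are reduced to supersolutions by changing signs; there weak
    continuity excludes infinite critical slopes, and the continuity of F is used
    to move each slope up to the level set {H_a = l}. *)

Set Implicit Arguments.
Unset Strict Implicit.
Unset Printing Implicit Defensive.

Import Order.TTheory GRing.Theory Num.Theory numFieldNormedType.Exports.

Local Open Scope classical_set_scope.
Local Open Scope ring_scope.

(** * Topology of the junction and semicontinuous envelopes *)

Section JunctionTopology.
Context {R : realType} {n : nat}.
Implicit Types (T : \bar R) (u v phi : R * 'rV[R]_n.+1 -> R)
  (z : R * 'rV[R]_n.+1) (a b : 'I_n.+1) (t x : R).

Lemma axisE a b x : axis a x 0 b = if b == a then x else 0.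
Proof. by rewrite /axis !mxE eqxx /=; case: (b == a); rewrite ?mulr1 ?mulr0. Qed.

Lemma axis0 a : axis a 0 = 0 :> 'rV[R]_n.+1.
Proof. by rewrite /axis scale0r. Qed.

Lemma dom_axis T a t x : time_interval T t -> 0 <= x -> dom T (t, axis a x).
Proof. by move=> Tt x0; split => //; exists a => //; exists x. Qed.

Lemma dom_axisP T z : dom T z ->
  exists a x, [/\ time_interval T z.1, 0 <= x & z = (z.1, axis a x)].
Proof.
case: z => t p [/= Tt [a _ [x /= x0 <-]]].
by exists a, x.
Qed.

Lemma near_dom_axis T a t0 x0 (P : set (R * 'rV[R]_n.+1)) :
  (\forall y \near within (dom T) (nbhs (t0, axis a x0)), P y) ->
  exists2 e : R, 0 < e & forall t x, time_interval T t -> 0 <= x ->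
    `|t - t0| < e -> `|x - x0| < e -> P (t, axis a x).
Proof.
rewrite near_withinE => /nbhs_ballP[e /= e0 eP]; exists e => // t x Tt x0' te xe.
apply: eP; last exact: dom_axis.
split; first by rewrite /ball /= distrC.
split=> // i b; rewrite ord1 !axisE /ball /=.
by case: ifP => _; rewrite ?subrr ?normr0 // distrC.
Qed.

(** There are finitely many branches, so the least of their radii serves all of them. Touching at
    the origin can thus be checked branch by branch. *)
Lemma near_dom_origin T t0 (P : set (R * 'rV[R]_n.+1)) :
  (forall a, exists2 e : R, 0 < e & forall t x, time_interval T t ->
     `|t - t0| < e -> 0 <= x < e -> P (t, axis a x)) ->
  \forall y \near within (dom T) (nbhs (t0, 0 : 'rV[R]_n.+1)), P y.
Proof.
move=> eP.
have [e ePP] := choice (fun a => (exists2P _ _).1 (eP a)).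
rewrite near_withinE; apply/nbhs_ballP.
pose d := \big[Num.min/1]_b e b.
have d0 : 0 < d by apply/bigmin_gtP; split => // b _; exact: (ePP b).1.
exists d => // z [/= zt [_ zx]] /dom_axisP[a [x [Tt x0 zE]]].
have de : d <= e a by apply: bigmin_le_cond.
have := zx ord0 a; rewrite {zx} zE /= axisE eqxx mxE /ball /= sub0r normrN => xd.
apply: (ePP a).2 => //.
  by apply: lt_le_trans de; rewrite distrC; exact: zt.
by rewrite x0 /=; apply: lt_le_trans de; rewrite -(ger0_norm x0).
Qed.

(** Capping the radius by [x0] keeps the ball off the other branches, whose points have coordinate 0
    along [a]. *)
Lemma near_dom_open_branch T a t0 x0 (P : set (R * 'rV[R]_n.+1)) : 0 < x0 ->
  (exists2 e : R, 0 < e & forall t x, time_interval T t -> 0 <= x ->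
     `|t - t0| < e -> `|x - x0| < e -> P (t, axis a x)) ->
  \forall y \near within (dom T) (nbhs (t0, axis a x0)), P y.
Proof.
move=> x00 [e e0 eP]; rewrite near_withinE; apply/nbhs_ballP.
exists (Num.min e x0); first by rewrite /= lt_min e0.
move=> z [/= zt [_ zx]] /dom_axisP[b [x [Tt x0' zE]]].
move: zx zt => /(_ ord0 a); rewrite /ball /= !lt_min => + /andP[zt _].
rewrite {}zE /= !axisE eqxx; case: eqP => [<-|_]; last first.
  by rewrite subr0 gtr0_norm // ltxx andbF.
by move=> /andP[xe _]; apply: eP => //; rewrite distrC.
Qed.

Lemma lsc_onP T v z m : lsc_on T v -> dom T z -> m < v z ->
  \forall y \near within (dom T) (nbhs z), m < v y.
Proof.
move=> lv zT mv; have [|V zV mV] := lv z m; first by rewrite lte_fin.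
move: zV; rewrite /nbhs /= -nbhs_subspace_in //; apply: filterS => y Vy.
by have := mV y Vy; rewrite lte_fin.
Qed.

(** Every neighbourhood contains [z], which bounds the envelope from above; the set where [v]
    exceeds [v z - e] is a relative neighbourhood by semicontinuity, which bounds it from below. *)
Lemma lsc_envelopeE T v z : lsc_on T v -> dom T z ->
  lsc_envelope T v z = (v z)%:E.
Proof.
move=> lv zT; rewrite /lsc_envelope limf_einfE; apply/eqP; rewrite eq_le.
apply/andP; split.
  apply: ge_ereal_sup => _ [V Vz <-]; apply: ereal_inf_lbound.
  by exists z => //; apply: nbhs_singleton Vz _.
apply/lee_subgt0Pr => e e0; rewrite -EFinB.
have := @lsc_onP T v z (v z - e) lv zT; rewrite ltrBlDr ltrDl => /(_ e0) nV.
apply: le_ereal_sup_tmp; exists (ereal_inf [set (v y)%:E | y in [set y | v z - e < v y]]).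
  by exists [set y | v z - e < v y].
by apply: le_ereal_inf_tmp => _ [y /= vy <-]; rewrite lee_fin ltW.
Qed.

Lemma time_interval_nbhs T t0 : time_interval T t0 ->
  exists2 e : R, 0 < e & forall t, `|t - t0| < e -> time_interval T t.
Proof.
case=> t00; case: T => [T| |] //= tT.
  rewrite lte_fin in tT.
  exists (Num.min t0 (T - t0)); first by rewrite lt_min t00 subr_gt0.
  move=> t; rewrite lt_min !ltr_norml => /andP[/andP[? ?] /andP[? ?]].
  by split; rewrite /= ?lte_fin; lra.
exists t0 => // t; rewrite ltr_norml => /andP[? _]; split => /=; last exact: ltry.
lra.
Qed.

End JunctionTopology.

(** * Bounds for the relaxation operator *)

Section Relaxation.
Context {R : realType} {n : nat}.
Implicit Types (h : R -> R) (H : 'I_n.+1 -> R -> R) (F G : 'rV[R]_n.+1 -> R)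
  (p q : 'rV[R]_n.+1) (a b : 'I_n.+1) (l s : R).

Lemma nonincreasing_lecomp F p q :
  nonincreasing_each F -> lecomp p q -> F q <= F p.
Proof.
move=> Fm pq.
(* Hybrid vectors: passing from [m k] to [m k.+1] changes only the coordinate [k], so monotonicity
   in one argument applies at each step. *)
pose m k : 'rV[R]_n.+1 := \row_b if (b < k)%N then q 0 b else p 0 b.
have mF k : (k <= n.+1)%N -> F (m k) <= F p.
  elim: k => [_|k IH kn].
    by rewrite (_ : m 0 = p) //; apply/rowP => b; rewrite mxE.
  apply: le_trans (IH (ltnW kn)); apply: (Fm (Ordinal kn)) => [b bk|].
    rewrite !mxE ltnS [(b <= k)%N]leq_eqVlt.
    by move: bk; rewrite -val_eqE /= => /negbTE ->.
  by rewrite !mxE /= ltnn ltnSn.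
rewrite (_ : q = m n.+1); first exact: mF.
by apply/rowP => b; rewrite mxE ltn_ord.
Qed.

Lemma Hmin_le H p a : Hmin H p <= H a (p 0 a).
Proof. exact: bigmin_le_cond. Qed.

Lemma Hmin_ge H p l : (forall a, l <= H a (p 0 a)) -> l <= Hmin H p.
Proof. by move=> lH; apply/bigmin_geP; split. Qed.

Lemma Hmin_gt H p l : (forall a, l < H a (p 0 a)) -> l < Hmin H p.
Proof. by move=> lH; apply/bigmin_gtP; split. Qed.

Lemma Hmax_ge H p a : H a (p 0 a) <= Hmax H p.
Proof. exact: le_bigmax_cond. Qed.

Lemma Hmax_le H p l : (forall a, H a (p 0 a) <= l) -> Hmax H p <= l.
Proof. by move=> lH; apply/bigmax_leP; split. Qed.

Lemma lecompxx p : lecomp p p. Proof. by move=> a. Qed.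

Lemma lecomp_trans p q r : lecomp p q -> lecomp q r -> lecomp p r.
Proof. by move=> pq qr a; exact: le_trans (pq a) (qr a). Qed.

(** Monotonicity makes [F p] a lower bound of the competitors, so the infimum is a genuine one and
    not a default value. *)
Lemma relax_super_le H F p q : nonincreasing_each F -> lecomp q p ->
  relax_super H F p <= Num.max (F q) (Hmax H q).
Proof.
move=> Fm qp; apply: ge_inf; last by exists q.
exists (F p) => _ [r /= rp <-].
by rewrite le_max (nonincreasing_lecomp Fm rp).
Qed.

Lemma relax_super_ge H F p l :
  (forall q, lecomp q p -> l <= Num.max (F q) (Hmax H q)) ->
  l <= relax_super H F p.
Proof.
move=> lF; apply: lb_le_inf.
  by exists (Num.max (F p) (Hmax H p)), p => //; exact: lecompxx.
by move=> _ [q /= qp <-]; exact: lF.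
Qed.

Lemma relax_super_ge_self H F p : nonincreasing_each F -> F p <= relax_super H F p.
Proof.
move=> Fm; apply: relax_super_ge => q qp.
by rewrite le_max (nonincreasing_lecomp Fm qp).
Qed.

(** The competitors of the supremum are bounded by [relax_super H F p], because [relax_super] is
    itself nonincreasing: a larger argument admits more vectors in its infimum. *)
Lemma relaxation_ge_min H F p q : nonincreasing_each F -> lecomp p q ->
  Num.min (relax_super H F q) (Hmin H q) <= relaxation H F p.
Proof.
move=> Fm pq; apply: ub_le_sup; last by exists q.
exists (relax_super H F p) => _ [r /= pr <-].
rewrite ge_min; apply/orP; left; apply: relax_super_ge => s sp.
by apply: relax_super_le => //; exact: lecomp_trans pr.
Qed.

Lemma relaxation_le_sup H F p l :
  (forall q, lecomp p q -> Num.min (relax_super H F q) (Hmin H q) <= l) ->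
  relaxation H F p <= l.
Proof.
move=> lF; apply: ge_sup.
  by exists (Num.min (relax_super H F p) (Hmin H p)), p => //; exact: lecompxx.
by move=> _ [q /= qp <-]; exact: lF.
Qed.

Lemma min_le_relaxation H F p : nonincreasing_each F ->
  Num.min (F p) (Hmin H p) <= relaxation H F p.
Proof.
move=> Fm; apply: le_trans (relaxation_ge_min H Fm (lecompxx p)).
by rewrite le_min !ge_min relax_super_ge_self // lexx orbT.
Qed.

Lemma relaxation_le_max H F p : nonincreasing_each F ->
  relaxation H F p <= Num.max (F p) (Hmax H p).
Proof.
move=> Fm; apply: relaxation_le_sup => q pq.
by rewrite ge_min relax_super_le.
Qed.

(** The point is the supremum of the sublevel set {h <= l} in [s, q]; continuity keeps it in that
    set, and [l < h q] keeps it away from [q]. *)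
Lemma last_point_below h l s (q : R) : continuous h -> s < q -> h s <= l -> l < h q ->
  exists s', [/\ s <= s', s' < q, h s' <= l &
    forall x, s' < x -> x <= q -> l < h x].
Proof.
move=> hc sq hs hq.
pose A := [set x | s <= x <= q /\ h x <= l].
have As : A s by split => //; rewrite lexx ltW.
have supA : has_sup A.
  by split; [exists s | exists q => x [/andP[]]].
have A_sup x : A x -> x <= sup A by move=> Ax; apply: ub_le_sup => //; case: supA.
have sA : s <= sup A by exact: A_sup.
have Aq : sup A <= q by apply: ge_sup; [exists s | move=> x [/andP[]]].
have hA : h (sup A) <= l.
  rewrite leNgt; apply/negP => lh.
  have /nbhs_ballP[e /= e0 he] : \forall x \near sup A, l < h x.
    by apply: (cvgr_gt _ (hc (sup A))).
  have [x Ax xe] := sup_adherent e0 supA.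
  have : l < h x.
    apply: he; rewrite /ball /= ger0_norm; first by lra.
    by rewrite subr_ge0; exact: A_sup.
  by case: Ax => _; rewrite leNgt => /negP.
exists (sup A); split => //.
  rewrite lt_neqAle Aq andbT; apply/eqP => AE.
  by move: hA; rewrite AE leNgt hq.
move=> x Ax xq; rewrite ltNge; apply/negP => hx.
suff : x <= sup A by rewrite leNgt Ax.
by apply: A_sup; split => //; rewrite xq andbT; lra.
Qed.

(** [S a] stands for the slopes along [a] at which the weak condition can be tested. The vector of
    the [s] is the competitor in the supremum: any [r] below it either has all its coordinates in
    [S], or has one where [H a] is at least [l], and then so is [Hmax]. *)
Lemma relaxation_ge H F (S : 'I_n.+1 -> set R) p l : nonincreasing_each F ->
  (forall a, exists s, [/\ p 0 a <= s, l <= H a s &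
     forall s', s' <= s -> S a s' \/ l <= H a s']) ->
  (forall q, (forall a, S a (q 0 a)) -> l <= Num.max (F q) (Hmax H q)) ->
  l <= relaxation H F p.
Proof.
move=> Fm /choice[s sP] SF.
pose q : 'rV[R]_n.+1 := \row_a s a.
have pq : lecomp p q by move=> a; rewrite mxE; have [] := sP a.
apply: le_trans (relaxation_ge_min H Fm pq).
rewrite le_min; apply/andP; split; last first.
  by apply: Hmin_ge => a; rewrite mxE; have [] := sP a.
apply: relax_super_ge => r rq.
have [rS|] := pselect (forall a, S a (r 0 a)); first exact: SF.
move=> /existsNP[a rS]; rewrite le_max; apply/orP; right.
apply: le_trans (Hmax_ge H r a).
have [_ _ /(_ (r 0 a))] := sP a.
by have := rq a; rewrite mxE => ra /(_ ra)[].
Qed.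

(* Unless Hmin q <= l, each slope q_a can be lowered to the last level point
   q'_a of {H_a <= l} below q_a, which lies above the critical slope s_a; just
   above q' all H_a exceed l, so there F <= l, hence F q' <= l by continuity. *)
Lemma relaxation_le H F (S : 'I_n.+1 -> set R) p l :
  nonincreasing_each F -> continuous F -> (forall a, continuous (H a)) ->
  (forall a, exists s, [/\ s <= p 0 a, H a s <= l &
     forall s', s < s' -> S a s']) ->
  (forall q, (forall a, S a (q 0 a)) -> Num.min (F q) (Hmin H q) <= l) ->
  relaxation H F p <= l.
Proof.
move=> Fm Fc Hc /choice[s sP] SF.
apply: relaxation_le_sup => q pq; rewrite ge_min.
have [_|lH] := leP (Hmin H q) l; first by rewrite orbT.
rewrite orbF.
have lHq a : l < H a (q 0 a) by exact: lt_le_trans (Hmin_le H q a).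
have /choice[r rP] a : exists r, [/\ s a <= r, r < q 0 a, H a r <= l &
    forall x, r < x -> x <= q 0 a -> l < H a x].
  have [sp Hs _] := sP a; apply: last_point_below => //.
  rewrite lt_neqAle (le_trans sp (pq a)) andbT.
  by apply/eqP => sq; have := lHq a; rewrite -sq ltNge Hs.
pose q' : 'rV[R]_n.+1 := \row_a r a.
have q'q : lecomp q' q by move=> a; rewrite mxE; have [_ /ltW] := rP a.
apply: le_trans (relax_super_le H Fm q'q) _.
rewrite ge_max; apply/andP; split; last first.
  by apply: Hmax_le => a; rewrite mxE; have [] := rP a.
rewrite leNgt; apply/negP => lF.
have qc : {for 0, continuous (fun e : R => q' + e *: (q - q'))}.
  apply: cvgD; first exact: cvg_cst.
  by apply: cvgZ; [exact: cvg_id | exact: cvg_cst].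
have /nbhs_ballP[e /= e0 eF] : \forall e \near (0 : R), l < F (q' + e *: (q - q')).
  have : F (q' + e *: (q - q')) @[e --> (0:R)] --> F (q' + 0 *: (q - q')).
    by apply: continuous_comp; [exact: qc | exact: Fc].
  by rewrite scale0r addr0 => /cvgr_gt; apply.
(* [d <= 1] keeps [q2] below [q], in the range where all [H a] exceed [l]; [d < e] keeps [F q2]
   above [l]. *)
pose d := Num.min (e / 2) 1.
have d0 : 0 < d by rewrite lt_min ltr01 divr_gt0.
have d1 : d <= 1 by rewrite ge_min lexx orbT.
have de : d < e by rewrite gt_min; apply/orP; left; lra.
pose q2 := q' + d *: (q - q').
have q2r a : r a < q2 0 a <= q 0 a.
  have [_ rq _ _] := rP a; rewrite !mxE.
  by apply/andP; split; nra.
have := SF q2; rewrite leNgt lt_min.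
have -> : l < F q2 by apply: eF; rewrite /ball /= sub0r normrN gtr0_norm.
have -> : l < Hmin H q2.
  apply: Hmin_gt => a; have [_ _ _] := rP a.
  by have /andP[q2a q2b] := q2r a; apply.
move=> /(_ _)/negP; apply => // a; have [_ _] := sP a; apply.
have [sr _ _ _] := rP a; apply: le_lt_trans sr _.
by case/andP: (q2r a).
Qed.

End Relaxation.

(** * Test functions perturbed in time and along each branch *)

Section Perturbation.
Context {R : realType} {n : nat}.
Implicit Types (T : \bar R) (phi : R * 'rV[R]_n.+1 -> R)
  (a b : 'I_n.+1) (t r : R).

(** Points to the right of [r] remain in every punctured neighbourhood; properness makes the limit
    defining [d_x] unique. *)
Lemma within_ge0_dnbhs_proper r :
  0 <= r -> ProperFilter (within [set s : R | 0 <= s] r^').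
Proof.
move=> r0; apply: Build_ProperFilter_ex.
move=> P; rewrite /within /= /dnbhs /within /= => /nbhs_ballP[e /= e0 eP].
exists (r + e / 2); apply: eP => /=; last by lra.
  by rewrite /ball /= opprD addrA subrr sub0r normrN gtr0_norm; lra.
by apply/eqP => H; lra.
Qed.

(** In Caratheodory's form the difference quotient agrees off [r] with a function continuous at [r],
    so its limit survives the restriction to nonnegative points. *)
Lemma is_derive_quotient (g : R -> R) r d : is_derive r 1 g d ->
  (g s - g r) / (s - r) @[s --> within [set s : R | 0 <= s] r^'] --> d.
Proof.
move=> /is_derive1_caratheodory[k [gE kc <-]].
apply: cvg_trans (_ : k s @[s --> within [set s : R | 0 <= s] r^'] --> k r).
  apply: near_eq_cvg; rewrite near_withinE /dnbhs near_withinE.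
  near=> s => /eqP sr _; rewrite gE mulfK // subr_eq0; exact/eqP.
apply: cvg_trans kc; apply: cvg_app.
by apply: cvg_trans (cvg_within _) _; exact: cvg_within.
Unshelve. all: by end_near.
Qed.

(** Each [g b] acts on one coordinate of the ambient space. On branch [a] the other coordinates
    vanish, so the other [g b] contribute constants, and continuity across the origin follows from
    that of the [g b]. *)
Definition perturb phi (h : R -> R) (g : 'I_n.+1 -> R -> R) z : R :=
  phi z + h z.1 + \sum_b g b (z.2 0 b).

Section PerturbTheory.
Variables (T : \bar R) (phi : R * 'rV[R]_n.+1 -> R).
Variables (h dh : R -> R) (g dg : 'I_n.+1 -> R -> R).
Hypothesis phiT : test_function T phi.
Hypothesis dhE : forall t, is_derive t 1 h (dh t).
Hypothesis dhc : continuous dh.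
Hypothesis dgE : forall a r, is_derive r 1 (g a) (dg a r).
Hypothesis dgc : forall a, continuous (dg a).

Let psi := perturb phi h g.

Lemma perturb_axis t a r : perturb phi h g (t, axis a r) =
  phi (t, axis a r) + h t + g a r + \sum_(b | b != a) g b 0.
Proof.
rewrite /perturb (bigD1 a) //= axisE eqxx !addrA; congr (_ + _).
by apply: eq_bigr => b /negbTE ba; rewrite axisE ba.
Qed.

Lemma perturb_branch_quotient a t r : branch_quotient psi a t r =
  branch_quotient phi a t r \+ (fun s => (g a s - g a r) / (s - r)).
Proof.
apply/funext => s; rewrite /= /branch_quotient -mulrDl /psi !perturb_axis.
congr (_ / _); ring.
Qed.

Lemma perturb_branch_cvg a t r : time_interval T t -> 0 <= r ->
  branch_quotient psi a t r s @[s --> within [set s | 0 <= s] r^'] -->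
  d_x phi a t r + dg a r.
Proof.
move=> Tt r0; rewrite perturb_branch_quotient.
have [_ C1] := phiT; have [_ cx _ _] := C1 a.
have FF := within_ge0_dnbhs_proper r0.
apply: cvgD; last exact: is_derive_quotient.
exact: cx.
Qed.

Lemma d_x_perturb a t r : time_interval T t -> 0 <= r ->
  d_x psi a t r = d_x phi a t r + dg a r.
Proof.
move=> Tt r0; have FF := within_ge0_dnbhs_proper r0.
by apply: cvg_lim => //; exact: perturb_branch_cvg.
Qed.

Lemma perturb_time_derive a t r : time_interval T t -> 0 <= r ->
  is_derive t 1 (fun s => psi (s, axis a r)) (d_t phi (t, axis a r) + dh t).
Proof.
move=> Tt r0; have [_ C1] := phiT; have [ct _ _ _] := C1 a.
have -> : (fun s => psi (s, axis a r)) = (fun s => phi (s, axis a r)) + h +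
    cst (g a r + \sum_(b | b != a) g b 0).
  by apply/funext => s; rewrite /psi perturb_axis /= !fctE -!addrA.
have H : is_derive t 1 (fun s => phi (s, axis a r)) (d_t phi (t, axis a r)).
  by rewrite /d_t derive1E; apply: DeriveDef => //; apply: ct.
rewrite -[X in is_derive _ _ _ X]addr0.
apply: is_deriveD.
Qed.

Lemma d_t_perturb a t r : time_interval T t -> 0 <= r ->
  d_t psi (t, axis a r) = d_t phi (t, axis a r) + dh t.
Proof.
move=> Tt r0; rewrite {1}/d_t derive1E /=.
by have /@derive_val := perturb_time_derive a Tt r0.
Qed.

Lemma continuous_perturb_term :
  continuous (fun z : R * 'rV[R]_n.+1 => h z.1 + \sum_b g b (z.2 0 b)).
Proof.
have ctd (f df : R -> R) : (forall x : R, is_derive x 1 f (df x)) -> continuous f.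
  move=> fE x; apply: differentiable_continuous; apply/derivable1_diffP.
  by have [] := fE x.
move=> z; apply: cvgD.
  by apply: continuous_comp; [exact: cvg_fst | exact: ctd dhE _].
apply: cvg_big => [|b _]; first exact: add_continuous.
apply: (@continuous_comp _ _ _ (fun z : R * 'rV[R]_n.+1 => z.2 0 b) (g b)).
  apply: (@continuous_comp _ _ _ snd (fun p : 'rV[R]_n.+1 => p 0 b)).
    exact: cvg_snd.
  exact: coord_continuous.
exact: ctd (dgE b) _.
Qed.

Lemma test_function_perturb : test_function T psi.
Proof.
have [phic C1] := phiT; split.
  move=> z; rewrite (_ : psi = phi \+ fun z => h z.1 + \sum_b g b (z.2 0 b)).
    apply: cvgD; first exact: phic.
    exact: (continuous_subspaceT continuous_perturb_term).
  by apply/funext => y; rewrite /psi /perturb /= addrA.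
move=> a; have [_ _ dtc dxc] := C1 a; split => /=.
- by move=> t r [/= Tt r0]; have [] := perturb_time_derive a Tt r0.
- move=> t r [/= Tt r0]; apply/cvg_ex; exists (d_x phi a t r + dg a r).
  exact: perturb_branch_cvg.
(* The formulas for the derivatives are known on the strip only, so continuity is transferred
   through equality there. *)
- apply: (@subspace_eq_continuous _ _ _
      (fun y : R * R => d_t phi (y.1, axis a y.2) + dh y.1)).
    by move=> [t r] /set_mem[/= Tt r0]; rewrite /from_subspace /= d_t_perturb.
  move=> y; apply: cvgD; first exact: dtc.
  apply: (@continuous_subspaceT _ _ _ (fun y : R * R => dh y.1)) => {}y.
  by apply: continuous_comp; [exact: cvg_fst | exact: dhc].
- apply: (@subspace_eq_continuous _ _ _
      (fun y : R * R => d_x phi a y.1 y.2 + dg a y.2)).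
    by move=> [t r] /set_mem[/= Tt r0]; rewrite /from_subspace /= d_x_perturb.
  move=> y; apply: cvgD; first exact: dxc.
  apply: (@continuous_subspaceT _ _ _ (fun y : R * R => dg a y.2)) => {}y.
  by apply: continuous_comp; [exact: cvg_snd | exact: dgc].
Qed.

End PerturbTheory.
End Perturbation.

(** The sublevel sets [B z] are nested, hence a filter base. At a cluster point [z], a value
    [f y < f z] would give a neighbourhood on which [f] exceeds [f y], although it must meet
    [B y]. *)
Lemma compact_lsc_min (R : realType) (X : topologicalType) (K : set X)
    (f : X -> R) : compact K -> K !=set0 ->
  (forall z m, K z -> m < f z -> \forall y \near within K (nbhs z), m < f y) ->
  exists2 z, K z & forall y, K y -> f z <= f y.
Proof.
move=> cK [z0 Kz0] lf.
pose B z := [set y | K y /\ f y <= f z].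
have Bz z : K z -> B z z by [].
pose F := filter_from K B.
have FF : ProperFilter F.
  apply: filter_from_proper; last by move=> z Kz; exists z; exact: Bz.
  apply: filter_from_filter; first by exists z0.
  move=> y z Ky Kz; case: (leP (f y) (f z)) => yz; [exists y | exists z] => // x [Kx fx].
    by split; split => //; exact: le_trans yz.
  by split; split => //; exact: le_trans fx (ltW yz).
have FK : F K by exists z0 => // y [].
have [z [Kz clz]] := cK F FF FK.
exists z => // y Ky; rewrite leNgt; apply/negP => yz.
have By : F (B y) by exists y.
have [x [[Kx fx] /(_ Kx)]] := clz _ _ By (lf z (f y) Kz yz).
by rewrite ltNge fx.
Qed.

Lemma exists_lt3 (R : realFieldType) (x y z : R) : 0 < x -> 0 < y -> 0 < z ->
  exists r : R, [/\ 0 < r, r < x, r < y & r < z].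
Proof.
move=> x0 y0 z0; have m0 : 0 < Num.min x (Num.min y z) by rewrite !lt_min x0 y0.
have : Num.min x (Num.min y z) <= Num.min x (Num.min y z) by [].
rewrite !le_min => /and3P[mx my mz].
by exists (Num.min x (Num.min y z) / 2); split; lra.
Qed.

(** * Touching points inside a branch and critical slopes *)

Section CriticalSlope.
Context {R : realType} {n : nat}.
Implicit Types (T : \bar R) (v phi psi : R * 'rV[R]_n.+1 -> R)
  (a b : 'I_n.+1) (t r : R) (h : R -> R).

(** A single branch is retained, with an arbitrary [h]: it will be [H a] for supersolutions and
    [fun s => - H a (- s)] for subsolutions with their sign changed. *)
Definition interior_supersolution T a h v :=
  forall phi t r, test_function T phi -> time_interval T t -> 0 < r ->
    (\forall y \near within (dom T) (nbhs (t, axis a r)), phi y <= v y) ->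
    v (t, axis a r) = phi (t, axis a r) ->
    0 <= d_t phi (t, axis a r) + h (d_x phi a t r).

Lemma test_function_addr T phi (c : R) : test_function T phi ->
  [/\ test_function T (fun z => phi z + c),
    forall a t r, time_interval T t -> 0 <= r ->
      d_t (fun z => phi z + c) (t, axis a r) = d_t phi (t, axis a r) &
    forall a t r, time_interval T t -> 0 <= r ->
      d_x (fun z => phi z + c) a t r = d_x phi a t r].
Proof.
move=> phiT.
have -> : (fun z => phi z + c) = perturb phi (cst c) (fun=> cst 0).
  by apply/funext => z; rewrite /perturb /= big1 // addr0.
have dc (k t : R) : is_derive t 1 (cst k) (cst 0 t) by exact: is_derive_cst.
have d0 (b : 'I_n.+1) := dc 0.
have cc : continuous (cst 0 : R -> R) by move=> ?; exact: cvg_cst.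
have c0 (b : 'I_n.+1) := cc.
split.
- exact: (test_function_perturb phiT (dc c) cc d0 c0).
- by move=> a t r Tt r0; rewrite (d_t_perturb _ phiT (dc c)) // addr0.
- by move=> a t r Tt r0; rewrite (d_x_perturb _ phiT d0) // addr0.
Qed.

(** The minimum of [v - psi] over the box is negative while the difference is nonnegative on the
    boundary, so it is attained inside; adding this minimum to [psi] gives a test function touching
    [v] from below there. *)
Lemma interior_touch T v a h psi t0 r : lsc_on T v -> test_function T psi ->
  interior_supersolution T a h v ->
  (forall t, `|t - t0| <= r -> time_interval T t) ->
  (forall t x, `|t - t0| <= r -> 0 <= x <= r ->
     `|t - t0| = r \/ x = 0 \/ x = r -> psi (t, axis a x) <= v (t, axis a x)) ->
  (exists t (x : R), [/\ `|t - t0| <= r, 0 <= x <= r &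
     v (t, axis a x) < psi (t, axis a x)]) ->
  exists t (x : R), [/\ `|t - t0| < r, 0 < x < r &
     0 <= d_t psi (t, axis a x) + h (d_x psi a t x)].
Proof.
move=> lv psiT hv rT bd [t1 [x1 [t1r x1r v1]]].
pose K : set (R * R) := `[t0 - r, t0 + r] `*` `[0, r].
have KP t x : K (t, x) <-> `|t - t0| <= r /\ 0 <= x <= r.
  rewrite /K /= !in_itv /= ler_norml.
  suff -> : (t0 - r <= t <= t0 + r) = (- r <= t - t0 <= r) by [].
  by congr (_ && _); apply/idP/idP => ?; lra.
pose f (y : R * R) := v (y.1, axis a y.2) - psi (y.1, axis a y.2).
have [||[t x] m Ktx mf|[t x] /KP[tr xr] fmin] := @compact_lsc_min R _ K f.
- by apply: compact_setX; exact: segment_compact.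
- by exists (t1, x1); apply/KP.
- have [tr /andP[x0 xr]] := (KP t x).1 Ktx.
  (* The gap is split evenly between the semicontinuity of [v] and the continuity of [psi]. *)
  have Tt := rT _ tr; pose d := (f (t, x) - m) / 2.
  have d0 : 0 < d by rewrite divr_gt0 // subr_gt0.
  have nv : \forall y \near within (dom T) (nbhs (t, axis a x)),
      v (t, axis a x) - d < v y.
    apply: lsc_onP => //; first exact: dom_axis.
    by rewrite ltrBlDr ltrDl.
  have np : \forall y \near within (dom T) (nbhs (t, axis a x)),
      psi y < psi (t, axis a x) + d.
    have [/subspace_continuousP/(_ (t, axis a x) (dom_axis a Tt x0)) psic _] := psiT.
    by apply: (cvgr_lt _ psic); rewrite ltrDl.
  have [e e0 eP] := near_dom_axis (filterI nv np).
  rewrite near_withinE; apply/nbhs_ballP; exists e => //= -[s y] [/= st xy].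
  move=> /KP[sr /andP[y0 yr]].
  have [] := eP s y (rT _ sr) y0; rewrite 1?distrC // => vs ps.
  have : m = f (t, x) - d - d by rewrite /d; lra.
  by rewrite /f /= => ->; lra.
have vneg : f (t, x) < 0.
  apply: le_lt_trans (fmin (t1, x1) _) _; first exact/KP.
  by rewrite /f subr_lt0.
have bd' : ~ (`|t - t0| = r \/ x = 0 \/ x = r).
  by move/bd => /(_ tr xr); move: vneg; rewrite /f /= subr_lt0 ltNge => /negP.
have tr' : `|t - t0| < r.
  by rewrite lt_neqAle tr andbT; apply/eqP => E; apply: bd'; left.
have /andP[x0 xr'] : 0 < x < r.
  have x_0 : x != 0 by apply/eqP => E; apply: bd'; right; left.
  have x_r : x != r by apply/eqP => E; apply: bd'; right; right.
  by case/andP: xr => x0 xr; rewrite !lt_neqAle x0 xr x_r eq_sym x_0.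
exists t, x; split => //; first by rewrite x0.
have Tt := rT _ tr.
have [psiT' dt dx] := test_function_addr (f (t, x)) psiT.
rewrite -dt ?(ltW x0)// -dx ?(ltW x0)//.
apply: hv => //; last by rewrite /f /=; lra.
apply: near_dom_open_branch => //.
exists (Num.min (r - `|t - t0|) (r - x)).
  by rewrite lt_min !subr_gt0 tr'.
move=> s y Ts y0; rewrite !lt_min => /andP[sr _] /andP[_ yr].
have /fmin : K (s, y).
  apply/KP; split; last by move: yr; rewrite ltr_norml => /andP[_ yr]; lra.
  have -> : s - t0 = (s - t) + (t - t0) by ring.
  by apply: le_trans (ler_normD _ _) _; lra.
by rewrite {2}/f /=; lra.
Qed.

(** Prepares the two slope arguments below: [g] shapes the test function along the branch, and the
    parabola in time serves to keep the minimum off the sides |t - t0| = r. *)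
Lemma interior_touch_branch T v a h phi (g dg : R -> R) t0 tau r (K : R) :
  lsc_on T v -> test_function T phi -> interior_supersolution T a h v ->
  (forall x : R, is_derive x 1 g (dg x)) -> continuous dg ->
  (forall t, `|t - t0| <= r -> time_interval T t) ->
  (forall t x, `|t - t0| <= r -> 0 <= x <= r ->
     `|t - t0| = r \/ x = 0 \/ x = r ->
     phi (t, axis a x) + g x - K * (t - tau) ^+ 2 <= v (t, axis a x)) ->
  (exists t (x : R), [/\ `|t - t0| <= r, 0 <= x <= r &
     v (t, axis a x) < phi (t, axis a x) + g x - K * (t - tau) ^+ 2]) ->
  exists t (x : R), [/\ `|t - t0| < r, 0 < x < r &
     0 <= d_t phi (t, axis a x) - 2 * K * (t - tau) +
       h (d_x phi a t x + dg x)].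
Proof.
move=> lv phiT hv dgE dgc rT bd ex.
pose k t : R := - (K * (t - tau) ^+ 2).
pose dk t : R := - (2 * K * (t - tau)).
pose gg b := if b == a then g else cst 0.
pose dgg b := if b == a then dg else cst 0.
have dkE (t : R) : is_derive t 1 k (dk t).
  rewrite /k; apply: is_derive_eq.
  by rewrite /dk /GRing.scale /=; ring.
have dkc : continuous dk.
  move=> t; apply: cvgN; apply: cvgM; first exact: cvg_cst.
  by apply: cvgB; [exact: cvg_id | exact: cvg_cst].
have dggE b (x : R) : is_derive x 1 (gg b) (dgg b x).
  by rewrite /gg /dgg; case: ifP => _ //; exact: is_derive_cst.
have dggc b : continuous (dgg b).
  by rewrite /dgg; case: ifP => _ // => x; exact: cvg_cst.
have psiE t x : perturb phi k gg (t, axis a x) =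
    phi (t, axis a x) + g x - K * (t - tau) ^+ 2.
  rewrite perturb_axis /gg eqxx big1 ?addr0; first by rewrite /k addrAC.
  by move=> b /negbTE ->.
have [||t [x [tr xr H]]] := interior_touch lv
    (test_function_perturb phiT dkE dkc dggE dggc) hv rT.
- by move=> t x tr xr B; rewrite psiE; exact: bd.
- by case: ex => t [x [tr xr B]]; exists t, x; rewrite psiE.
exists t, x; split => //; move: H.
have Tt : time_interval T t by apply: rT; exact: ltW.
have x0 : 0 <= x by case/andP: xr => /ltW.
rewrite (d_t_perturb _ phiT dkE) // (d_x_perturb _ phiT dggE) //.
by rewrite /dgg eqxx.
Qed.

Lemma C1_near_origin T phi a t0 (d : R) :
  test_function T phi -> time_interval T t0 -> 0 < d ->
  exists2 e : R, 0 < e & forall t x, time_interval T t -> `|t - t0| < e ->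
    0 <= x < e -> `|d_t phi (t, axis a x) - d_t phi (t0, 0)| < d /\
      `|d_x phi a t x - d_x phi a t0 0| < d.
Proof.
move=> [_ C1] Tt0 d0; have [_ _ ct cx] := C1 a.
have S0 : (time_interval T `*` [set r : R | 0 <= r]) (t0, 0).
  by split => //=.
move: ct cx => /subspace_continuousP/(_ _ S0)/cvgrPdist_lt/(_ d d0) ct.
move=> /subspace_continuousP/(_ _ S0)/cvgrPdist_lt/(_ d d0) cx.
have : \forall y \near within (time_interval T `*` [set r : R | 0 <= r])
    (nbhs ((t0, 0) : R * R)),
    `|d_t phi (t0, axis a 0) - d_t phi (y.1, axis a y.2)| < d /\
    `|d_x phi a t0 0 - d_x phi a y.1 y.2| < d.
  exact: filterI ct cx.
rewrite near_withinE => /nbhs_ballP[e /= e0 eP].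
exists e => // t x Tt te /andP[x0 xe].
have [] := eP (t, x) _ _.
- by split; rewrite /ball /= distrC // subr0 ger0_norm.
- by split.
- by rewrite /= axis0 => *; split; rewrite distrC.
Qed.

(** [s] is a correction added to the slope of [phi]: the critical slope of the branch is
    [d_x phi a t0 0] plus the supremum of these corrections. *)
Definition slope_below T phi v a t0 (s : R) :=
  exists2 e : R, 0 < e & forall t x, time_interval T t -> `|t - t0| < e ->
    0 <= x < e -> phi (t, axis a x) + s * x <= v (t, axis a x).

Lemma slope_below_le T phi v a t0 s s' : s' <= s ->
  slope_below T phi v a t0 s -> slope_below T phi v a t0 s'.
Proof.
move=> ss [e e0 eP]; exists e => // t x Tt te xe.
apply: le_trans (eP t x Tt te xe); rewrite lerD2l ler_wpM2r //.
by case/andP: xe.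
Qed.

(* A point (t1, x1) near (t0, 0) violates the bound with slope s + eps. In a box
   of size r, the quadratic penalties centred at that point with coefficient
   K = 8 eps / r restore the bound on the boundary of the box while perturbing
   the derivatives by O(eps) only. *)
Lemma critical_slope T v a h phi t0 s : continuous h ->
  lsc_on T v -> test_function T phi -> interior_supersolution T a h v ->
  time_interval T t0 ->
  (forall s', s' < s -> slope_below T phi v a t0 s') ->
  (forall s', s < s' -> ~ slope_below T phi v a t0 s') ->
  0 <= d_t phi (t0, 0) + h (d_x phi a t0 0 + s).
Proof.
move=> hc lv phiT hv Tt0 sb snb; rewrite leNgt; apply/negP => m0.
set m := (X in X < 0) in m0.
have /nbhs_ballP[d1 /= d10 d1P] : \forall y \near d_x phi a t0 0 + s,
    h y < h (d_x phi a t0 0 + s) - m / 2.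
  by apply: (cvgr_lt _ (hc _)); lra.
have [d [d0 dd1 dm _]] := @exists_lt3 _ d1 (- m / 2) 1 d10 ltac:(lra) ltr01.
(* The derivatives of [phi] move by less than d / 4, the time penalty adds at most 24 eps, and the
   linear term with the space penalty at most 17 eps; with eps = d / 64 both totals stay below
   [d]. *)
have [eps [eps0 epsd]] : exists eps : R, 0 < eps /\ eps = d / 64.
  by exists (d / 64); split; lra.
have [e1 e10 e1P] := time_interval_nbhs Tt0.
have [|e2 e20 e2P] := @C1_near_origin T phi a t0 (d / 4) phiT Tt0.
  by lra.
have [|e3 e30 e3P] := sb (s - eps); first lra.
have [r [r0 re1 re2 re3]] := exists_lt3 e10 e20 e30.
pose K : R := 8 * eps / r.
have KE : K * r = 8 * eps by rewrite /K divfK // gt_eqF.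
have K0 : 0 < K by rewrite divr_gt0 // mulr_gt0.
have rT t : `|t - t0| <= r -> time_interval T t.
  by move=> tr; apply: e1P; exact: le_lt_trans re1.
have [t1 [x1 [t1r x1r vx1]]] : exists t (x : R), [/\ `|t - t0| < r / 2, 0 <= x < r / 2 &
    v (t, axis a x) < phi (t, axis a x) + (s + eps) * x].
  apply: contrapT => nex; apply: (snb (s + eps)); first lra.
  exists (r / 2); first by rewrite divr_gt0.
  move=> t x Tt tr xr; rewrite leNgt; apply/negP => vx.
  by apply: nex; exists t, x.
pose g x := (s + eps) * x - K * (x - x1) ^+ 2.
pose dg x := s + eps - 2 * K * (x - x1).
have dgE (x : R) : is_derive x 1 g (dg x).
  rewrite /g; apply: is_derive_eq.
  by rewrite /dg /GRing.scale /=; ring.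
have dgc : continuous dg.
  move=> x; apply: cvgB; first exact: cvg_cst.
  apply: cvgM; first exact: cvg_cst.
  by apply: cvgB; [exact: cvg_id | exact: cvg_cst].
(* At distance at least r / 2 from the centre, one penalty pays for the gap 2 eps x between the
   slopes s + eps and s - eps. On the side x = 0 the linear terms vanish. *)
have far y : r / 2 <= `|y| -> 2 * eps * r <= K * y ^+ 2.
  move=> yr; have : (r / 2) ^+ 2 <= y ^+ 2.
    rewrite -[y ^+ 2]real_normK ?num_real //.
    by rewrite ler_pXn2r // nnegrE; lra.
  move=> /(ler_wpM2l (ltW K0)); apply: le_trans.
  have -> : K * (r / 2) ^+ 2 = (K * r) * r / 4 by field.
  by rewrite KE; lra.
have [||t [x [tr /andP[x0 xr]]]] :=
    interior_touch_branch (tau := t1) (K := K) lv phiT hv dgE dgc rT.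
- move=> t x tr /andP[x0 xr] B.
  have := e3P t x (rT t tr) (le_lt_trans tr re3); rewrite x0 (le_lt_trans xr re3).
  move=> /(_ isT) lb; apply: le_trans lb.
  have p1 : 0 <= K * (t - t1) ^+ 2 by rewrite mulr_ge0 ?sqr_ge0 // ltW.
  have p2 : 0 <= K * (x - x1) ^+ 2 by rewrite mulr_ge0 ?sqr_ge0 // ltW.
  have xer : eps * x <= eps * r by rewrite ler_pM2l.
  case: B => [E|[E|E]].
  + have : 2 * eps * r <= K * (t - t1) ^+ 2.
      apply: far; have : `|t - t0| <= `|t - t1| + `|t1 - t0|.
        by apply: le_trans (ler_normD _ _); rewrite subrKA.
      by rewrite E; lra.
    by rewrite /g; lra.
  + by rewrite E /g /= !mulr0; rewrite E in p2; lra.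
  + have : 2 * eps * r <= K * (x - x1) ^+ 2.
      by apply: far; apply: le_trans (ler_norm _); rewrite E; lra.
    by rewrite /g; lra.
- exists t1, x1; split; first by lra.
    by apply/andP; split; lra.
  by rewrite /g !subrr expr0n /= mulr0 !subr0.
have [||dtP dxP] := e2P t x (rT t (ltW tr)); first by lra.
  by apply/andP; split; lra.
have tP : `|2 * K * (t - t1)| <= 24 * eps.
  rewrite normrM (ger0_norm (_ : 0 <= 2 * K)); last lra.
  have : `|t - t1| <= 3 / 2 * r.
    have : `|t - t1| <= `|t - t0| + `|t0 - t1|.
      by apply: le_trans (ler_normD _ _); rewrite subrKA.
    by rewrite (distrC t0); lra.
  move=> /(ler_wpM2l (_ : 0 <= 2 * K)) H; apply: le_trans (H _) _; first lra.
  have -> : 2 * K * (3 / 2 * r) = 3 * (K * r) by field.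
  by rewrite KE; lra.
have xP : `|2 * K * (x - x1)| <= 16 * eps.
  rewrite normrM (ger0_norm (_ : 0 <= 2 * K)); last lra.
  have : `|x - x1| <= r by rewrite ler_norml; apply/andP; split; lra.
  move=> /(ler_wpM2l (_ : 0 <= 2 * K)) H; apply: le_trans (H _) _; first lra.
  by rewrite -mulrA KE; lra.
move: dtP dxP tP xP; rewrite !ltr_norml !ler_norml.
move=> /andP[? ?] /andP[? ?] /andP[? ?] /andP[? ?].
have hy : h (d_x phi a t x + dg x) < h (d_x phi a t0 0 + s) - m / 2.
  apply: d1P; rewrite /ball /= ltr_norml /dg.
  by apply/andP; split; lra.
suff : m - m / 2 + d <= 0 by move: hy; rewrite /m; lra.
lra.
Qed.

(* Weak continuity gives points (t1, x1) arbitrarily close to (t0, 0) at which v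
   exceeds phi by little. The term A (1 - exp(- x / x1)) vanishes at 0, is already
   of order A at x1, stays below A and has a positive derivative, so it produces
   an interior touching point of slope at least M, where h is very negative. *)
Lemma exists_slope_not_below T v a h phi t0 :
  lsc_on T v -> test_function T phi -> interior_supersolution T a h v ->
  time_interval T t0 -> v (t0, 0) = phi (t0, 0) ->
  (forall L : R, exists B, forall y, B <= y -> h y < L) ->
  (forall e : R, 0 < e -> exists t (x : R), [/\ `|t - t0| < e, 0 < x < e &
     v (t, axis a x) < v (t0, 0) + e]) ->
  exists s, ~ slope_below T phi v a t0 s.
Proof.
move=> lv phiT hv Tt0 v0 hinf wc; apply/existsNP => sb.
(* The margin 2 absorbs the variation of [d_t phi], less than 1, and the time penalty, at most 4 r
   <= 1 / 2. The 1 added in [M] absorbs the variation of [d_x phi]. *)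
have [B BP] := hinf (- d_t phi (t0, 0) - 2).
pose M : R := Num.max 0 (B - d_x phi a t0 0 + 1).
have M0 : 0 <= M by rewrite le_max lexx.
have MB : B - d_x phi a t0 0 + 1 <= M by rewrite le_max lexx orbT.
clearbody M.
have [e1 e10 e1P] := time_interval_nbhs Tt0.
have [e2 e20 e2P] := C1_near_origin a phiT Tt0 ltr01.
have [e3 e30 e3P] := sb (M + 1).
have [e12 [e120 e12_8 e12_1 e12_2]] :=
  @exists_lt3 _ (1 / 8) e1 e2 ltac:(lra) e10 e20.
have [r [r0 r_e12 re3 _]] := exists_lt3 e120 e30 e30.
have [r1 re1 re2] : [/\ 8 * r <= 1, r < e1 & r < e2] by split; lra.
have rT t : `|t - t0| <= r -> time_interval T t.
  by move=> tr; apply: e1P; exact: le_lt_trans re1.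
(* This [A] is the least time penalty on the sides |t - t0| = r, so it covers the exponential term
   there; on the side x = r, [A <= r] lets the spare unit of slope in M + 1 cover it. *)
have [A [A0 AE]] : exists A : R, 0 < A /\ A = r ^+ 2 / 4.
  by exists (r ^+ 2 / 4); split => //; rewrite divr_gt0 // exprn_gt0.
have Ar : A <= r by rewrite AE; nra.
have near0 : \forall y \near within (dom T) (nbhs (t0, axis a 0)),
    phi (t0, 0) - A / 8 < phi y.
  have [/subspace_continuousP/(_ _ (dom_axis a Tt0 (lexx 0))) phic _] := phiT.
  by apply: (cvgr_gt _ phic); rewrite axis0 ltrBlDr ltrDl divr_gt0.
have [e4 e40 e4P] := near_dom_axis near0.
have [|t1 [x1 []]] := wc (Num.min (r / 2) (Num.min e4 (A / 8))).
  by rewrite !lt_min e40 (divr_gt0 r0) //= (divr_gt0 A0).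
rewrite !lt_min => /and3P[t1r t1e _] /andP[x10 /and3P[x1r x1e _]] v1.
have {}v1 : v (t1, axis a x1) < v (t0, 0) + A / 8.
  by apply: lt_le_trans v1 _; rewrite lerD2l !ge_min lexx !orbT.
pose g (x : R) := M * x + A * (1 - expR (- (x / x1))).
pose dg (x : R) := M + A / x1 * expR (- (x / x1)).
have dgE (x : R) : is_derive x 1 g (dg x).
  have H : is_derive x 1 (expR \o (fun x => - (x / x1))) (expR (- (x / x1)) * - x1^-1).
    apply: is_derive1_comp.
    by apply: is_derive_eq; rewrite /GRing.scale /=; ring.
  rewrite /g; apply: is_derive_eq.
  by rewrite /dg /GRing.scale /=; ring.
have dgc : continuous dg.
  move=> x; apply: cvgD; first exact: cvg_cst.
  apply: cvgM; first exact: cvg_cst.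
  have lin : (fun y : R => - (y / x1)) @ x --> - (x / x1).
    by apply: cvgN; apply: cvgM; [exact: cvg_id | exact: cvg_cst].
  exact: cvg_comp lin (@continuous_expR R _).
have exp_gt0 (x : R) : 0 < expR (- (x / x1)) by exact: expR_gt0.
have [||t [x [tr /andP[x0 xr]]]] :=
    interior_touch_branch (tau := t1) (K := 1) lv phiT hv dgE dgc rT.
- move=> t x tr /andP[x0 xr] bd.
  have := e3P t x (rT t tr) (le_lt_trans tr re3); rewrite x0 (le_lt_trans xr re3).
  move=> /(_ isT) lb; apply: le_trans lb; rewrite mul1r.
  have p1 : 0 <= (t - t1) ^+ 2 by exact: sqr_ge0.
  have Aexp : 0 < A * expR (- (x / x1)) by rewrite mulr_gt0.
  case: bd => [E|[E|E]].
  + have : r / 2 <= `|t - t1|.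
      have : `|t - t0| <= `|t - t1| + `|t1 - t0|.
        by apply: le_trans (ler_normD _ _); rewrite subrKA.
      by rewrite E; lra.
    move=> yr; have : (r / 2) ^+ 2 <= (t - t1) ^+ 2.
      rewrite -[(t - t1) ^+ 2]real_normK ?num_real //.
      by rewrite ler_pXn2r // nnegrE; lra.
    by rewrite /g; lra.
  + by rewrite E /g !mul0r oppr0 expR0 subrr !mulr0; lra.
  + by rewrite /g E in Aexp *; lra.
- exists t1, x1; split; first by lra.
    by apply/andP; split; lra.
  rewrite /g subrr expr0n /= mulr0 subr0 divff ?gt_eqF //.
  (* At x1 the exponential term is worth at least A / 2, more than the two errors A / 8 coming from
     [v1] and from the continuity of [phi]. *)
  have exp1 : 2 <= expR 1 :> R by have := expR_ge1Dx (1 : R); lra.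
  have expN1 : expR (-1) <= 1 / 2 :> R.
    by rewrite expRN -[1 / 2]invrK lef_pV2 ?posrE ?expR_gt0 // div1r invrK.
  have p1 : phi (t0, 0) - A / 8 < phi (t1, axis a x1).
    by apply: e4P => //; [apply: rT; lra | exact: ltW | rewrite subr0 gtr0_norm].
  have Mx : 0 <= M * x1 by rewrite mulr_ge0 // ltW.
  have Ae : A * (1 / 2) <= A * (1 - expR (-1)) by rewrite ler_pM2l //; lra.
  by lra.
have [||dtP dxP] := e2P t x (rT t (ltW tr)); first by lra.
  by apply/andP; split; lra.
have tP : `|t - t1| <= 2 * r.
  have : `|t - t1| <= `|t - t0| + `|t0 - t1|.
    by apply: le_trans (ler_normD _ _); rewrite subrKA.
  by rewrite (distrC t0); lra.
have dgM : M < dg x by rewrite ltrDl mulr_gt0 // divr_gt0.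
move: dtP dxP tP; rewrite !ltr_norml !ler_norml.
move=> /andP[? ?] /andP[? ?] /andP[? ?].
have : h (d_x phi a t x + dg x) < - d_t phi (t0, 0) - 2 by apply: BP; lra.
lra.
Qed.

End CriticalSlope.

(** * Weak and strong solutions at the junction point *)

Section Solutions.
Context {R : realType} {n : nat}.
Implicit Types (T : \bar R) (u v phi psi : R * 'rV[R]_n.+1 -> R)
  (a b : 'I_n.+1) (t r : R) (h : R -> R) (H : 'I_n.+1 -> R -> R)
  (F G : 'rV[R]_n.+1 -> R).

Lemma dom_origin T t : time_interval T t -> dom T (t, 0 : 'rV[R]_n.+1).
Proof. by move=> Tt; rewrite -(axis0 ord0); exact: dom_axis. Qed.

Lemma usc_envelopeE T u z : usc_on T u -> dom T z ->
  usc_envelope T u z = (u z)%:E.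
Proof.
move=> uu zT; rewrite /usc_envelope -[LHS]oppeK -limf_einfN.
have := lsc_envelopeE uu zT; rewrite /lsc_envelope.
have -> : EFin \o (fun z => - u z) = (\- (EFin \o u))%E.
  by apply/funext => y; rewrite /= EFinN.
by move=> ->; rewrite -EFinN opprK.
Qed.

Lemma touches_belowP T phi v z : lsc_on T v -> dom T z ->
  touches_below T phi (lsc_envelope T v) z <->
  (\forall y \near within (dom T) (nbhs z), phi y <= v y) /\ v z = phi z.
Proof.
move=> lv zT; rewrite /touches_below lsc_envelopeE //.
rewrite !near_withinE; split=> -[nr eq]; split; rewrite ?eq //; last first.
- by apply: filterS nr => y yP Ty; rewrite lsc_envelopeE // lee_fin; exact: yP.
- by case: eq.
- apply: filterS nr => y yP Ty; have := yP Ty.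
  by rewrite lsc_envelopeE // lee_fin.
Qed.

Lemma touches_aboveP T phi u z : usc_on T u -> dom T z ->
  touches_above T phi (usc_envelope T u) z <->
  (\forall y \near within (dom T) (nbhs z), u y <= phi y) /\ u z = phi z.
Proof.
move=> uu zT; rewrite /touches_above usc_envelopeE //.
rewrite !near_withinE; split=> -[nr eq]; split; rewrite ?eq //; last first.
- by apply: filterS nr => y yP Ty; rewrite usc_envelopeE // lee_fin; exact: yP.
- by case: eq.
- apply: filterS nr => y yP Ty; have := yP Ty.
  by rewrite usc_envelopeE // lee_fin.
Qed.

Lemma test_functionN T phi : test_function T phi ->
  [/\ test_function T (fun z => - phi z),
    forall a t r, time_interval T t -> 0 <= r ->
      d_t (fun z => - phi z) (t, axis a r) = - d_t phi (t, axis a r) &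
    forall a t r, time_interval T t -> 0 <= r ->
      d_x (fun z => - phi z) a t r = - d_x phi a t r].
Proof.
move=> [phic C1].
have bq a t r : branch_quotient (fun z => - phi z) a t r =
    \- branch_quotient phi a t r.
  by apply/funext => s; rewrite /= /branch_quotient -mulNr opprD.
have cx a t r : time_interval T t -> 0 <= r ->
    branch_quotient (fun z => - phi z) a t r s
      @[s --> within [set s | 0 <= s] r^'] --> - d_x phi a t r.
  move=> Tt r0; have FF := within_ge0_dnbhs_proper r0.
  rewrite bq; apply: cvgN; have [_ cx _ _] := C1 a; exact: cx.
have dx a t r : time_interval T t -> 0 <= r ->
    d_x (fun z => - phi z) a t r = - d_x phi a t r.
  move=> Tt r0; have FF := within_ge0_dnbhs_proper r0.
  by apply: cvg_lim => //; exact: cx.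
have ct a t r : time_interval T t -> 0 <= r ->
    derivable (fun s => phi (s, axis a r)) t 1.
  by move=> Tt r0; have [ct _ _ _] := C1 a; exact: ct.
have dt a t r : time_interval T t -> 0 <= r ->
    d_t (fun z => - phi z) (t, axis a r) = - d_t phi (t, axis a r).
  by move=> Tt r0; rewrite /d_t !derive1E /=; apply: deriveN; exact: ct.
split => //; split; first by move=> z; apply: cvgN; exact: phic.
move=> a; have [_ _ dtc dxc] := C1 a; split => /=.
- by move=> t r [/= Tt r0]; apply: derivableN; exact: ct.
- by move=> t r [/= Tt r0]; apply/cvg_ex; exists (- d_x phi a t r); exact: cx.
- apply: (@subspace_eq_continuous _ _ _
      (fun y : R * R => - d_t phi (y.1, axis a y.2))).
    by move=> [t r] /set_mem[/= Tt r0]; rewrite /from_subspace /= dt.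
  by move=> y; apply: cvgN; exact: dtc.
- apply: (@subspace_eq_continuous _ _ _
      (fun y : R * R => - d_x phi a y.1 y.2)).
    by move=> [t r] /set_mem[/= Tt r0]; rewrite /from_subspace /= dx.
  by move=> y; apply: cvgN; exact: dxc.
Qed.

Lemma supersolution_interior T H G v a : lsc_on T v ->
  supersolution T H G v -> interior_supersolution T a (H a) v.
Proof.
move=> lv [_ sv] phi t r phiT Tt r0 nr eq.
have [+ _] := sv phi t phiT Tt; apply => //.
by apply/touches_belowP => //; exact/dom_axis/ltW.
Qed.

(** If [phi] touches [- u] from below, then [- phi] touches [u] from above with both derivatives
    negated, whence the two signs in the Hamiltonian. *)
Lemma subsolution_interior T H G u a : usc_on T u -> subsolution T H G u ->
  interior_supersolution T a (fun s => - H a (- s)) (fun z => - u z).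
Proof.
move=> uu [_ su] phi t r phiT Tt r0 nr eq.
have [phiNT dt dx] := test_functionN phiT.
have [/(_ a r r0) + _] := su _ t phiNT Tt.
rewrite (dt a t r Tt (ltW r0)) (dx a t r Tt (ltW r0)) => su'.
suff : touches_above T (fun z => - phi z) (usc_envelope T u) (t, axis a r).
  by move=> /su'; lra.
apply/touches_aboveP => //; first exact/dom_axis/ltW.
split; last by rewrite -eq opprK.
by apply: filterS nr => y; rewrite lerNr.
Qed.

(** A linear correction on each branch, chosen independently, realises any gradient [q] below the
    critical slopes without losing the contact at the origin. The weak condition can then be tested
    at [q]. *)
Lemma slopes_perturb T phi v t0 (q : 'rV[R]_n.+1) :
  test_function T phi -> time_interval T t0 -> v (t0, 0) = phi (t0, 0) ->
  (forall a, slope_below T phi v a t0 (q 0 a - d_x phi a t0 0)) ->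
  exists psi, [/\ test_function T psi,
    \forall y \near within (dom T) (nbhs (t0, 0 : 'rV[R]_n.+1)), psi y <= v y,
    v (t0, 0) = psi (t0, 0), d_t psi (t0, 0) = d_t phi (t0, 0) &
    grad0 psi t0 = q].
Proof.
move=> phiT Tt0 v0 sb.
pose m b : R := q 0 b - d_x phi b t0 0.
have dh (t : R) : is_derive t 1 (cst 0 : R -> R) (cst 0 t) by exact: is_derive_cst.
have hc : continuous (cst 0 : R -> R) by move=> ?; exact: cvg_cst.
have dg b (x : R) : is_derive x 1 ( *%R (m b)) (cst (m b) x).
  have := is_deriveZ (m b) (is_derive_id x (1 : R)).
  by rewrite /GRing.scale /= mulr1.
have gc b : continuous (cst (m b) : R -> R) by move=> ?; exact: cvg_cst.
have psiE a t x : perturb phi (cst 0) (fun b => *%R (m b)) (t, axis a x) =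
    phi (t, axis a x) + m a * x.
  by rewrite perturb_axis /= big1 ?addr0 // => b _; rewrite mulr0.
exists (perturb phi (cst 0) (fun b => *%R (m b))); split.
- exact: test_function_perturb phiT dh hc dg gc.
- apply: near_dom_origin => a; have [e e0 eP] := sb a.
  by exists e => // t x Tt te xe; rewrite psiE; exact: eP.
- by rewrite -(axis0 ord0) psiE mulr0 addr0 axis0.
- by rewrite -(axis0 ord0) (d_t_perturb _ phiT dh) // addr0.
- by apply/rowP => a; rewrite mxE (d_x_perturb _ phiT dg) // addrC subrK.
Qed.

(** Since [phi] touches from below, 0 is an admissible correction; the admissible ones are downward
    closed, so they either exhaust the line or have a finite supremum, to which [critical_slope]
    applies. *)
Lemma critical_slope_cases T v a h phi t0 : continuous h ->
  lsc_on T v -> test_function T phi -> interior_supersolution T a h v ->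
  time_interval T t0 ->
  (\forall y \near within (dom T) (nbhs (t0, 0 : 'rV[R]_n.+1)), phi y <= v y) ->
  (forall s, slope_below T phi v a t0 s) \/
  exists s, [/\ 0 <= s, forall s', s' < s -> slope_below T phi v a t0 s' &
    0 <= d_t phi (t0, 0) + h (d_x phi a t0 0 + s)].
Proof.
move=> hc lv phiT hv Tt0 nr.
have [|/existsNP[s0 ns0]] := pselect (forall s, slope_below T phi v a t0 s).
  by left.
right; pose S := [set s | slope_below T phi v a t0 s].
have S0 : S 0.
  move: nr; rewrite -(axis0 a) => /near_dom_axis[e e0 eP].
  exists e => // t x Tt te /andP[x0 xe]; rewrite mul0r addr0.
  by apply: eP => //; rewrite subr0 ger0_norm.
have S_ub : ubound S s0.
  move=> s Ss; rewrite leNgt; apply/negP => s0s; apply: ns0.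
  by apply: slope_below_le Ss; exact: ltW.
have supS : has_sup S by split; [exists 0 | exists s0].
have S_sup s : S s -> s <= sup S by move=> Ss; apply: ub_le_sup => //; case: supS.
have below s : s < sup S -> S s.
  move=> sS; have sS0 : 0 < sup S - s by rewrite subr_gt0.
  have [s' Ss' ss'] := sup_adherent sS0 supS.
  by apply: slope_below_le Ss'; lra.
exists (sup S); split => //; first exact: S_sup.
apply: (critical_slope hc lv phiT hv Tt0 below) => s sS /S_sup.
by rewrite leNgt sS.
Qed.

(** The upper limit is an infimum of suprema over neighbourhoods; the box of size [e] is one of
    them, so its supremum is at least [u (t0, 0)]. *)
Lemma weakly_continuous_seq T u t0 a (e : R) : weakly_continuous T u ->
  time_interval T t0 -> 0 < e -> exists t (x : R), [/\ `|t - t0| < e, 0 < x < e &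
    u (t0, 0) - e < u (t, axis a x)].
Proof.
move=> wu Tt0 e0; have := wu t0 Tt0 a; rewrite limf_esupE => uE.
pose V := [set z | exists t (x : R), [/\ `|t - t0| < e, 0 < x < e & z = (t, axis a x)]].
have VP : within (time_interval T `*` open_branch a)
    (nbhs (t0, 0 : 'rV[R]_n.+1)) V.
  apply/nbhs_ballP; exists e => // -[t p] [/= te [_ pe]] [/= _ [x x0 xp]].
  exists t, x; split; [by rewrite distrC | | by rewrite xp].
  have := pe ord0 a; rewrite -xp axisE eqxx mxE /ball /= sub0r normrN gtr0_norm //.
  by move=> ->; rewrite andbT.
have : ((u (t0, 0) - e)%:E < ereal_sup ((EFin \o u) @` V))%E.
  apply: (@lt_le_trans _ _ (u (t0, 0))%:E); first by rewrite lte_fin; lra.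
  by rewrite uE; apply: ereal_inf_lbound; exists V.
move=> /ereal_sup_gt[_ [z [t [x [te xe ->]]] <-]]; rewrite lte_fin => ue.
by exists t, x.
Qed.

Lemma weak_supersolution_strong T H F v :
  (forall a, continuous (H a)) -> (forall a, coercive (H a)) ->
  nonincreasing_each F -> lsc_on T v ->
  weak_supersolution T H F v -> strong_supersolution T H (relaxation H F) v.
Proof.
move=> Hc Hcoer Fm lv wv; split; first by case: wv.
move=> phi t0 phiT Tt0; split.
  by have [+ _] := wv.2 phi t0 phiT Tt0.
move=> /(touches_belowP _ lv (dom_origin Tt0))[nr v0].
(* [S] contains actual slopes, hence the subtraction of the slope of [phi]. *)
pose S a (s : R) := slope_below T phi v a t0 (s - d_x phi a t0 0).
suff : - d_t phi (t0, 0) <= relaxation H F (grad0 phi t0) by lra.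
apply: (@relaxation_ge _ _ H F S) => // [a|q qS].
  rewrite mxE.
  have hv := supersolution_interior (a := a) lv wv.
  have [all|[s [s0 sb sH]]] :=
      critical_slope_cases (Hc a) lv phiT hv Tt0 nr.
    have [/cvgryPge/(_ (- d_t phi (t0, 0)))[M [_ MP]] _] := Hcoer a.
    exists (Num.max (d_x phi a t0 0) (M + 1)); split.
    - by rewrite le_max lexx.
    - by apply: MP; rewrite /= lt_max ltrDl ltr01 orbT.
    - by move=> s' _; left; exact: all.
  exists (d_x phi a t0 0 + s); split; [by rewrite lerDl | by lra |].
  (* The critical slope itself may fail to be admissible, but there the bound on [H a] holds. *)
  move=> s'; rewrite le_eqVlt => /predU1P[->|ss]; first by right; lra.
  by left; apply: sb; lra.
have [psi [psiT npsi vpsi dt gr]] := slopes_perturb phiT Tt0 v0 qS.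
have [_] := wv.2 psi t0 psiT Tt0; rewrite dt gr => wpsi.
suff : touches_below T psi (lsc_envelope T v) (t0, 0) by move=> /wpsi; lra.
exact/(touches_belowP _ lv (dom_origin Tt0)).
Qed.

Lemma weak_subsolution_strong T H F u :
  (forall a, continuous (H a)) -> (forall a, coercive (H a)) ->
  nonincreasing_each F -> continuous F -> usc_on T u ->
  weakly_continuous T u ->
  weak_subsolution T H F u -> strong_subsolution T H (relaxation H F) u.
Proof.
move=> Hc Hcoer Fm Fc uu wc wu; split; first by case: wu.
move=> phi t0 phiT Tt0; split.
  by have [+ _] := wu.2 phi t0 phiT Tt0.
move=> /(touches_aboveP _ uu (dom_origin Tt0))[nr u0].
pose v z := - u z; have lv : lsc_on T v by [].
have [phiNT dt dx] := test_functionN phiT.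
set phiN := (fun z => - phi z) in phiNT dt dx.
have dt0 : d_t phiN (t0, 0) = - d_t phi (t0, 0).
  by rewrite -(axis0 ord0); exact: dt.
have dx0 a : d_x phiN a t0 0 = - d_x phi a t0 0 by exact: dx.
have v0 : v (t0, 0) = phiN (t0, 0) by rewrite /v u0.
have nv : \forall y \near within (dom T) (nbhs (t0, 0 : 'rV[R]_n.+1)), phiN y <= v y.
  by apply: filterS nr => y; rewrite lerN2.
(* A slope [s] for [u] is the slope [- s] for [v], again counted relative to the test function. *)
pose S a (s : R) := slope_below T phiN v a t0 (- s - d_x phiN a t0 0).
suff : relaxation H F (grad0 phi t0) <= - d_t phi (t0, 0) by lra.
apply: (@relaxation_le _ _ H F S) => // [a|q qS].
  rewrite mxE.
  have hv := subsolution_interior (a := a) uu wu.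
  have hc : continuous (fun s => - H a (- s)).
    move=> s; apply: cvgN.
    by apply: (@continuous_comp _ _ _ -%R (H a)); [exact: opp_continuous | exact: Hc].
  (* After the change of sign, coercivity at -oo becomes divergence to -oo for large slopes. *)
  have hinf (L : R) : exists B, forall y, B <= y -> - H a (- y) < L.
    have [_ /cvgryPgt/(_ (- L))[M [_ MP]]] := Hcoer a.
    exists (- M + 1) => y By; rewrite ltrNl; apply: MP => /=; lra.
  have wv (e : R) : 0 < e -> exists t (x : R), [/\ `|t - t0| < e, 0 < x < e &
      v (t, axis a x) < v (t0, 0) + e].
    move=> /(weakly_continuous_seq a wc Tt0)[t [x [te xe ue]]].
    by exists t, x; split => //; rewrite /v; lra.
  have [s0 ns0] := exists_slope_not_below lv phiNT hv Tt0 v0 hinf wv.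
  have [/(_ s0)//|[s [s_ge0 sb sH]]] := critical_slope_cases hc lv phiNT hv Tt0 nv.
  exists (- (d_x phiN a t0 0 + s)); split.
  - by rewrite dx0; lra.
  - by move: sH; rewrite dt0; lra.
  - by move=> s' ss; apply: sb; lra.
have [|psi [psiT npsi vpsi dpsi gr]] := @slopes_perturb T phiN v t0 (- q) phiNT Tt0 v0.
  by move=> a; rewrite mxE; exact: qS.
have [psiNT dtN dxN] := test_functionN psiT.
have dt1 : d_t (fun z => - psi z) (t0, 0) = d_t phi (t0, 0).
  by rewrite -(axis0 ord0) dtN // axis0 dpsi dt0 opprK.
have gr1 : grad0 (fun z => - psi z) t0 = q.
  by rewrite -[q]opprK -gr; apply/rowP => a; rewrite !mxE dxN.
have [_] := wu.2 _ t0 psiNT Tt0; rewrite dt1 gr1 => wpsi.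
suff : touches_above T (fun z => - psi z) (usc_envelope T u) (t0, 0).
  by move=> /wpsi; lra.
apply/(touches_aboveP _ uu (dom_origin Tt0)); split.
  by apply: filterS npsi => y; rewrite lerNr.
by rewrite -vpsi /v opprK.
Qed.

(** Only the condition at the origin involves the junction function, and it weakens as that function
    decreases; this yields the passage from strong to weak. *)
Lemma subsolution_le T H G1 G2 u : (forall p, G1 p <= G2 p) ->
  subsolution T H G2 u -> subsolution T H G1 u.
Proof.
move=> G12 [bu su]; split => // phi t phiT Tt.
have [su1 su2] := su phi t phiT Tt; split => // /su2; apply: le_trans.
by rewrite lerD2l.
Qed.

Lemma supersolution_le T H G1 G2 v : (forall p, G1 p <= G2 p) ->
  supersolution T H G1 v -> supersolution T H G2 v.
Proof.
move=> G12 [bv sv]; split => // phi t phiT Tt.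
have [sv1 sv2] := sv phi t phiT Tt; split => // /sv2/le_trans; apply.
by rewrite lerD2l.
Qed.

End Solutions.

Theorem proposition5p9 (R : realType) (n : nat) (H : 'I_n.+1 -> R -> R)
    (F0 : 'rV[R]_n.+1 -> R) (T : \bar R)
    (Hcont : forall a, continuous (H a))
    (Hcoer : forall a, coercive (H a))
    (F0cont : continuous F0)
    (F0mono : nonincreasing_each F0)
    (T_gt0 : (0 < T)%E) :
  (forall u : R * 'rV[R]_n.+1 -> R, usc_on T u ->
     (weak_subsolution T H F0 u -> weakly_continuous T u ->
        strong_subsolution T H (relaxation H F0) u) /\
     (strong_subsolution T H (relaxation H F0) u ->
        weak_subsolution T H F0 u)) /\
  (forall v : R * 'rV[R]_n.+1 -> R, lsc_on T v ->
     (weak_supersolution T H F0 v ->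
        strong_supersolution T H (relaxation H F0) v) /\
     (strong_supersolution T H (relaxation H F0) v ->
        weak_supersolution T H F0 v)).
Proof.
split=> [u uu|v lv]; split.
- by move=> wu wc; exact: weak_subsolution_strong.
- by apply: subsolution_le => p; exact: min_le_relaxation.
- exact: weak_supersolution_strong.
- by apply: supersolution_le => p; exact: relaxation_le_max.
Qed.
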